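(* Let $X$ be a Jacobson topological space. Then the topos $\mathbf{Sh}(X)$ of sheaves (of sets) on $X$ is EILC.
   Context: A topological space $X$ is called Jacobson if, writing $X_0 \subseteq X$ for the subspace of closed points of $X$, for all open subsets $U,V \subseteq X$ the equality $U \cap X_0 = V \cap X_0$ implies $U = V$. A geometric morphism $f : \mathcal{F} \to \mathcal{E}$ between elementary toposes is essential if the inverse image functor $f^*$ has a left adjoint, written $f_!$. It is locally connected if it is essential and for all morphisms $A \to B$ in $\mathcal{E}$ and $X \to f^*B$ in $\mathcal{F}$ the natural morphism $f_!(X \times_{f^*B} f^*A) \to f_!(X) \times_B A$ is an isomorphism (here $f_!(X)\to B$ is the adjoint transpose of $X \to f^*B$). An elementary topos $\mathcal{E}$ is EILC if every essential geometric morphism $f : \mathcal{F} \to \mathcal{E}$ (with $\mathcal{F}$ an elementary topos) is locally connected. *)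

(* Defs.v *)
From mathcomp Require Import all_boot.
From mathcomp Require Import boolp classical_sets topology.

Set Implicit Arguments.
Unset Strict Implicit.
Unset Printing Implicit Defensive.

Local Open Scope classical_set_scope.

(* Morphisms are compared with Leibniz equality. *)

Record category := Category {
  ob :> Type;
  hom : ob -> ob -> Type;
  idm : forall A, hom A A;
  comp : forall A B C, hom B C -> hom A B -> hom A C;
  comp_idl : forall A B (f : hom A B), comp (idm B) f = f;
  comp_idr : forall A B (f : hom A B), comp f (idm A) = f;
  comp_assoc : forall A B C D (h : hom C D) (g : hom B C) (f : hom A B),
    comp h (comp g f) = comp (comp h g) f
}.

Arguments hom {c} A B.
Arguments idm {c} A.
Arguments comp {c A B C} g f.

Notation "g \oc f" := (comp g f) (at level 40, left associativity).

Section Category.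
Variable C : category.

Definition is_mono (A B : C) (m : hom A B) : Prop :=
  forall (Z : C) (g h : hom Z A), m \oc g = m \oc h -> g = h.

Definition is_iso (A B : C) (f : hom A B) : Prop :=
  exists g : hom B A, g \oc f = idm A /\ f \oc g = idm B.

Definition is_terminal (T : C) : Prop :=
  forall Z : C, exists! t : hom Z T, True.

Definition is_product (A B P : C) (p1 : hom P A) (p2 : hom P B) : Prop :=
  forall (Z : C) (z1 : hom Z A) (z2 : hom Z B),
    exists! z : hom Z P, p1 \oc z = z1 /\ p2 \oc z = z2.

(*      p2
    P ----> B
    |       |
  p1|       |g
    v       v
    A ----> D
        f       *)
Definition is_pullback (A B D P : C) (f : hom A D) (g : hom B D)
    (p1 : hom P A) (p2 : hom P B) : Prop :=
  f \oc p1 = g \oc p2 /\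
  forall (Z : C) (z1 : hom Z A) (z2 : hom Z B), f \oc z1 = g \oc z2 ->
    exists! z : hom Z P, p1 \oc z = z1 /\ p2 \oc z = z2.

Definition has_finite_limits : Prop :=
  (exists T : C, is_terminal T) /\
  forall (A B D : C) (f : hom A D) (g : hom B D),
    exists (P : C) (p1 : hom P A) (p2 : hom P B), is_pullback f g p1 p2.

(* [ev : E * A -> B] exhibits [E] as the exponential [B ^ A]: every
   [g : Z * A -> B] factors as [ev \oc (u * A)] for a unique [u : Z -> E].
   Products are given by arbitrary product cones, and [k] below is the map
   [u * A], the only one satisfying the first two equations. *)
Definition is_exponential (A B E P : C) (p1 : hom P E) (p2 : hom P A)
    (ev : hom P B) : Prop :=
  is_product p1 p2 /\
  forall (Z Q : C) (q1 : hom Q Z) (q2 : hom Q A), is_product q1 q2 ->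
  forall g : hom Q B, exists! u : hom Z E, exists k : hom Q P,
    [/\ p1 \oc k = u \oc q1, p2 \oc k = q2 & ev \oc k = g].

Definition has_exponentials : Prop :=
  forall A B : C, exists (E P : C) (p1 : hom P E) (p2 : hom P A) (ev : hom P B),
    is_exponential p1 p2 ev.

Definition is_subobject_classifier (T Omega : C) (tr : hom T Omega) : Prop :=
  is_terminal T /\
  forall (S A : C) (m : hom S A), is_mono m ->
    exists! chi : hom A Omega, exists t : hom S T, is_pullback chi tr m t.

Definition has_subobject_classifier : Prop :=
  exists (T Omega : C) (tr : hom T Omega), is_subobject_classifier tr.

Definition elementary_topos : Prop :=
  [/\ has_finite_limits, has_exponentials & has_subobject_classifier].

End Category.

Record functor (C D : category) := Functor {
  fob :> C -> D;
  fmap : forall A B : C, hom A B -> hom (fob A) (fob B);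
  fmap_id : forall A : C, fmap (idm A) = idm (fob A);
  fmap_comp : forall (A B E : C) (g : hom B E) (f : hom A B),
    fmap (g \oc f) = fmap g \oc fmap f
}.

Arguments fmap {C D} _ {A B} _.

Definition preserves_finite_limits (C D : category) (G : functor C D) : Prop :=
  (forall T : C, is_terminal T -> is_terminal (G T)) /\
  forall (A B E P : C) (f : hom A E) (g : hom B E) (p1 : hom P A) (p2 : hom P B),
    is_pullback f g p1 p2 ->
    is_pullback (fmap G f) (fmap G g) (fmap G p1) (fmap G p2).

(* [L] is left adjoint to [R]. *)
Record adjunction (C D : category) (L : functor C D) (R : functor D C) :=
  Adjunction {
  transp : forall (A : C) (B : D), hom (L A) B -> hom A (R B);
  untransp : forall (A : C) (B : D), hom A (R B) -> hom (L A) B;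
  transpK : forall (A : C) (B : D), cancel (@transp A B) (@untransp A B);
  untranspK : forall (A : C) (B : D), cancel (@untransp A B) (@transp A B);
  transp_nat : forall (A A' : C) (B B' : D)
      (a : hom A' A) (b : hom B B') (f : hom (L A) B),
    transp (b \oc (f \oc fmap L a)) = fmap R b \oc (transp f \oc a)
}.

Arguments transp {C D L R} _ {A B} _.
Arguments untransp {C D L R} _ {A B} _.

Record geometric_morphism (F E : category) := GeometricMorphism {
  direct_image : functor F E;
  inverse_image : functor E F;
  inverse_direct_adj : adjunction inverse_image direct_image;
  inverse_image_lex : preserves_finite_limits inverse_image
}.

Definition essential (F E : category) (f : geometric_morphism F E) : Prop :=
  exists fshriek : functor F E, inhabited (adjunction fshriek (inverse_image f)).

(* For [X -> f^*B] and [A -> B], [P] is a pullback [X x_(f^*B) f^*A], [Q] is a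
   pullback [f_!(X) x_B A], and [u] is the map [f_!(P) -> Q] with components
   [f_!(p1)] and the transpose of [p2]. *)
Definition locally_connected (F E : category) (f : geometric_morphism F E) :
    Prop :=
  exists (fshriek : functor F E) (adj : adjunction fshriek (inverse_image f)),
  forall (A B : E) (a : hom A B) (X : F) (x : hom X (inverse_image f B))
    (P : F) (p1 : hom P X) (p2 : hom P (inverse_image f A))
    (Q : E) (q1 : hom Q (fshriek X)) (q2 : hom Q A),
    is_pullback x (fmap (inverse_image f) a) p1 p2 ->
    is_pullback (untransp adj x) a q1 q2 ->
    exists u : hom (fshriek P) Q,
      [/\ q1 \oc u = fmap fshriek p1, q2 \oc u = untransp adj p2 & is_iso u].

Definition EILC (E : category) : Prop :=
  elementary_topos E /\
  forall F : category, elementary_topos F ->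
  forall f : geometric_morphism F E, essential f -> locally_connected f.

(* Sheaves of sets on a topological space. Types, with Leibniz equality, play
   the role of sets. *)

Section Sheaves.
Variable X : topologicalType.

Definition opens := {U : set X | open U}.

Definition opens_set (U : opens) : set X := sval U.
Coercion opens_set : opens >-> set.

Definition openI_opens (U V : opens) : opens :=
  exist _ (U `&` V) (openI (svalP U) (svalP V)).

Record presheaf := Presheaf {
  sect :> opens -> Type;
  res : forall U V : opens, V `<=` U -> sect U -> sect V;
  res_id : forall (U : opens) (UU : U `<=` U) (s : sect U), res UU s = s;
  res_comp : forall (U V W : opens) (VU : V `<=` U) (WV : W `<=` V)
      (WU : W `<=` U) (s : sect U),
    res WV (res VU s) = res WU s
}.

Definition compatible (F : presheaf) (I : Type) (U : I -> opens)
    (s : forall i, F (U i)) : Prop :=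
  forall i j, res (V := openI_opens (U i) (U j)) (@subIsetl _ _ _) (s i) =
              res (V := openI_opens (U i) (U j)) (@subIsetr _ _ _) (s j).

Definition is_sheaf (F : presheaf) : Prop :=
  forall (V : opens) (I : Type) (U : I -> opens) (UV : forall i, U i `<=` V),
    (V : set X) = \bigcup_i U i ->
  forall s : forall i, F (U i), compatible s ->
    exists! t : F V, forall i, res (UV i) t = s i.

Record sheaf := Sheaf {
  sheaf_presheaf :> presheaf;
  sheafP : is_sheaf sheaf_presheaf
}.

Record sheaf_hom (F G : sheaf) := SheafHom {
  sheaf_app :> forall U : opens, F U -> G U;
  sheaf_app_res : forall (U V : opens) (VU : V `<=` U) (s : F U),
    sheaf_app (res VU s) = res VU (sheaf_app s)
}.

Lemma sheaf_hom_eq (F G : sheaf) (f g : sheaf_hom F G) :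
  (forall (U : opens) (s : F U), f U s = g U s) -> f = g.
Proof.
case: f g => [f fP] [g gP] /= fg.
have {}fg : f = g by apply: functional_extensionality_dep => U; apply/funext/fg.
by case: _ / fg in gP *; rewrite (Prop_irrelevance fP gP).
Qed.

Definition sheaf_id (F : sheaf) : sheaf_hom F F :=
  @SheafHom F F (fun U s => s) (fun U V VU s => erefl).

Lemma sheaf_comp_res (F G H : sheaf) (g : sheaf_hom G H) (f : sheaf_hom F G)
    (U V : opens) (VU : V `<=` U) (s : F U) :
  g V (f V (res VU s)) = res VU (g U (f U s)).
Proof. by rewrite !sheaf_app_res. Qed.

Definition sheaf_comp (F G H : sheaf) (g : sheaf_hom G H) (f : sheaf_hom F G) :
  sheaf_hom F H := SheafHom (sheaf_comp_res g f).

Definition Sh : category.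
Proof.
by apply: (@Category sheaf sheaf_hom sheaf_id sheaf_comp) => *; apply: sheaf_hom_eq.
Defined.

End Sheaves.

Definition closed_points (X : topologicalType) : set X :=
  [set x | closed [set x]].
Arguments closed_points : clear implicits.

Definition Jacobson (X : topologicalType) : Prop :=
  forall U V : set X, open U -> open V ->
    U `&` closed_points X = V `&` closed_points X -> U = V.

(* Main.v *)
From Pilot Require Import Defs.
From mathcomp Require Import all_boot.
From mathcomp Require Import topology.
From mathcomp Require Import boolp classical_sets.
(* A second import, so that [fmap] is the action of a functor on morphisms and
   not the image of a filter. *)
Import Pilot.Defs.

(** Let [f : F -> Sh X] be essential, with [f_!] left adjoint to [f^*].  Given
    [y : Y -> f^* B] and [a : A -> B], put [Q := f_! Y x_B A], with projection
    [q : Q -> f_! Y].  By pasting, the pullback [P := Y x_(f^* B) f^* A] is also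
    the pullback of [f^* q] along the unit [Y -> f^* f_! Y] ([unit_pullback]), and
    the map to be inverted is the transpose [f_! P -> Q] of the projection
    [kappa : P -> f^* Q].

    On a Jacobson space, a sheaf map [u : M -> Q] is invertible as soon as, for
    every closed point [x], every map from [M] to the skyscraper sheaf [sky x] with
    stalk [Prop] factors uniquely through [u] ([jacobson_iso]): the germs at [x] are
    separated by maps to [sky x], and an open set that contains the closed points
    of [U] contains [U].  Transposing, one has to show that every
    [phi : P -> f^* (sky x)] is [f^* r \oc kappa] for a unique [r : Q -> sky x]
    ([family_factor]).

    The heart of the proof is the case of a single section [d] of [D := f_! Y] over
    an open [U] ([component_factor], [component_inj]).  As [x] is closed, [D] is
    covered by [d] and by the subsheaf of the sections whose germ at [x] differs
    from that of [d]; the two pieces only meet away from [x], where [sky x] is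
    terminal.  Hence a map to [f^* (sky x)] defined on the part [Yd] of [Y] over
    [d] extends, by a constant, to all of [Y]; its transpose is a map
    [D -> sky x], to be restricted along [d].  The general case follows, since
    [Q] is covered by its sections.

    These arguments glue maps in [F], which need have no infinite colimits.  What
    makes them work is that a covering family [A_i -> A] in [Sh X] stays effective
    epic when its image by [f^*] is pulled back along any [P -> f^* A]
    ([pullback_epic], [pullback_glue]).  Indeed subobjects of [K x f^* A] are maps
    from [f^* A] to the power object of [K]; such maps glue because [f^*] is a left
    adjoint, and a map [P -> N] is a subobject of [P x N] of a special kind.

    Sheaves form an elementary topos by the usual constructions: pullbacks are
    computed on sections, the sections over [U] of the exponential are the maps
    [U x A -> B], and those of the subobject classifier are the opens in [U]. *)

Set Implicit Arguments.
Unset Strict Implicit.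
Unset Printing Implicit Defensive.

Local Open Scope classical_set_scope.

(** [x \at U] says that the point [x] lies in the open [U]. *)
Local Notation "x '\at' U" := (opens_set U x) (at level 70, no associativity).

(** * Sheaves on a space: gluing, sections, finite limits *)

Lemma choice_fun (A : Type) (B : A -> Type) (P : forall a, B a -> Prop) :
  (forall a, exists b, P a b) -> exists f : forall a, B a, forall a, P a (f a).
Proof.
by move=> h; exists (fun a => sval (cid (h a))) => a; case: (cid (h a)).
Qed.

Section Sheaves.
Variable X : topologicalType.

Lemma subset_irr (A B : set X) (h h' : A `<=` B) : h = h'.
Proof. exact: Prop_irrelevance. Qed.

Lemma openIl (U V : opens X) : openI_opens U V `<=` U.
Proof. by move=> x []. Qed.

Lemma openIr (U V : opens X) : openI_opens U V `<=` V.
Proof. by move=> x []. Qed.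

Lemma open_local (A : set X) :
  (forall x, A x -> exists V : opens X, x \at V /\ V `<=` A) -> open A.
Proof.
move=> h.
have -> : A = \bigcup_(V in [set V : opens X | V `<=` A]) (V : set X).
  by apply/seteqP; split=> [x /h [V [Vx VA]]|x [V /= VA]]; [exists V|apply: VA].
by apply: bigcup_open => V _; case: V.
Qed.

Section Presheaf.
Variable F : presheaf X.

Lemma res_irr (U V : opens X) (h h' : V `<=` U) (s : F U) : res h s = res h' s.
Proof. by rewrite (Prop_irrelevance h h'). Qed.

Lemma res_resE (U V W : opens X) (VU : V `<=` U) (WV : W `<=` V) (s : F U) :
  res WV (res VU s) = res (subset_trans WV VU) s.
Proof. exact: res_comp. Qed.

Lemma res_comm (U V V' W : opens X) (VU : V `<=` U) (WV : W `<=` V)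
    (VU' : V' `<=` U) (WV' : W `<=` V') (s : F U) :
  res WV (res VU s) = res WV' (res VU' s).
Proof. by rewrite !res_resE; apply: res_irr. Qed.
End Presheaf.

Lemma sheaf_sep (F : sheaf X) (V : opens X) (s t : F V) :
  (forall x, x \at V -> exists (W : opens X) (WV : W `<=` V),
     x \at W /\ res WV s = res WV t) ->
  s = t.
Proof.
move=> h.
pose I := {W : opens X | exists WV : W `<=` V, res WV s = res WV t}.
pose U (i : I) : opens X := sval i.
have UV (i : I) : U i `<=` V by case: (svalP i).
have cov : (V : set X) = \bigcup_i U i.
  apply/seteqP; split => [x /h [W [WV [Wx e]]]|x [i _]]; last exact: UV.
  by exists (exist _ W (ex_intro _ WV e)).
have cmp : compatible (U := U) (fun i => res (@UV i) s).
  by move=> i j; apply: res_comm.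
have [t0 [_ u]] := sheafP UV cov cmp.
rewrite -(u s) //; apply: u => i; case: (svalP i) => WV e.
by rewrite !(res_irr _ WV).
Qed.

(** Gluing of a family of sections given by a predicate: [P] holds of at most one
    section over each open, is stable under restriction, and holds of some section
    around each point of [V]. *)
Lemma sheaf_glue (F : sheaf X) (V : opens X)
    (P : forall W : opens X, F W -> Prop) :
  (forall (W W' : opens X) (h : W' `<=` W) (s : F W),
     P W s -> P W' (res h s)) ->
  (forall (W : opens X) (s t : F W), P W s -> P W t -> s = t) ->
  (forall x, x \at V -> exists (W : opens X) (s : F W),
     [/\ W `<=` V, x \at W & P W s]) ->
  exists t : F V, forall (W : opens X) (s : F W) (WV : W `<=` V),
    P W s -> res WV t = s.
Proof.
move=> Pres Puniq Pex.
pose I := {W : opens X & {s : F W | W `<=` V /\ P W s}}.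
pose U (i : I) := projT1 i.
pose s (i : I) : F (U i) := sval (projT2 i).
have UV (i : I) : U i `<=` V by case: (svalP (projT2 i)).
have Ps i : P _ (s i) by case: (svalP (projT2 i)).
have cov : (V : set X) = \bigcup_i U i.
  apply/seteqP; split => [x /Pex [W [t [WV Wx e]]]|x [i _]]; last exact: UV.
  by exists (existT _ W (exist _ t (conj WV e))).
have cmp : compatible s by move=> i j; apply: Puniq; apply: Pres.
have [t [tE _]] := sheafP UV cov cmp.
exists t => W w WV Pw.
have := tE (existT _ W (exist _ w (conj WV Pw))); rewrite /s /= => <-.
exact: res_irr.
Qed.

(** The sheaf represented by the open [U]: its set of sections over [V] is the
    proposition that [V] is contained in [U]. *)
Definition yo_presheaf (U : opens X) : presheaf X.
Proof.
by refine (@Presheaf X (fun V => V `<=` U)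
  (fun V W WV VU => subset_trans WV VU) _ _) => *; apply: subset_irr.
Defined.

Lemma yo_is_sheaf (U : opens X) : is_sheaf (yo_presheaf U).
Proof.
move=> V I W WV cov s cmp; have VU : V `<=` U by rewrite cov => x [i _] /(s i).
by exists VU; split=> [i|*]; apply: subset_irr.
Qed.

Definition yo U : Sh X := Sheaf (@yo_is_sheaf U).

(** The map from [yo U] that corresponds to a section over [U] by the Yoneda
    lemma. *)
Definition sec (F : sheaf X) (U : opens X) (s : F U) : sheaf_hom (yo U) F.
Proof.
by refine (@SheafHom X (yo U) F (fun V VU => res VU s) _) => V W WV VU;
  rewrite res_resE.
Defined.

Lemma sec_comp (F G : Sh X) (g : hom F G) (U : opens X) (s : F U) :
  g \oc sec s = sec (g U s) :> hom (yo U) G.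
Proof. by apply: sheaf_hom_eq => V VU /=; rewrite sheaf_app_res. Qed.

Lemma sec_inj (F : sheaf X) U (s t : F U) : sec s = sec t -> s = t.
Proof.
move=> /(congr1 (fun g : sheaf_hom (yo U) F => g U (@subset_refl _ U))) /=.
by rewrite !res_id.
Qed.

Lemma sh_mono_inj (F G : Sh X) (m : hom F G) (U : opens X) (s t : F U) :
  is_mono m -> m U s = m U t -> s = t.
Proof. by move=> mm e; apply: sec_inj; apply: mm; rewrite !sec_comp e. Qed.

Lemma sig_eq (T : Type) (P : T -> Prop) (a b : {x | P x}) :
  sval a = sval b -> a = b.
Proof. by case: a b => [a pa] [b pb] /= e; apply: eq_exist. Qed.

(** The subsheaf cut out by a predicate on sections that is stable under
    restriction and local. *)
Section Subsheaf.
Variables (F : sheaf X) (P : forall U : opens X, F U -> Prop).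
Hypothesis Pres : forall (U V : opens X) (VU : V `<=` U) (s : F U),
  P s -> P (res VU s).
Hypothesis Ploc : forall (V : opens X) (s : F V),
  (forall x, x \at V -> exists (W : opens X) (WV : W `<=` V),
     x \at W /\ P (res WV s)) ->
  P s.

Definition sub_presheaf : presheaf X.
Proof.
refine (@Presheaf X (fun U => {s : F U | P s})
  (fun U V VU s => exist _ (res VU (sval s)) (Pres VU (svalP s))) _ _).
- by move=> U UU s; apply: sig_eq; rewrite /= res_id.
- by move=> U V W VU WV WU s; apply: sig_eq; rewrite /= (res_comp VU WV WU).
Defined.

Lemma sub_is_sheaf : is_sheaf sub_presheaf.
Proof.
move=> V I U UV cov s cmp.
have cmp' : compatible (fun i => sval (s i)).
  by move=> i j; have := congr1 sval (cmp i j).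
have [t [tE tu]] := sheafP UV cov cmp'.
have Pt : P t.
  apply: Ploc => x Vx; have [i _ Ux] : (\bigcup_i U i) x by rewrite -cov.
  by exists (U i), (UV i); split=> //; rewrite tE; apply: svalP.
exists (exist _ t Pt); split=> [i|t' t'E]; apply: sig_eq => /=; first exact: tE.
by apply: tu => i; rewrite -t'E.
Qed.

Definition subsheaf : sheaf X := Sheaf sub_is_sheaf.

Definition subsheaf_incl : sheaf_hom subsheaf F.
Proof. by refine (@SheafHom X subsheaf F (fun U s => sval s) _). Defined.

Lemma subsheaf_lift (Z : sheaf X) (g : sheaf_hom Z F) :
  (forall U z, P (g U z)) ->
  exists k : sheaf_hom Z subsheaf, sheaf_comp subsheaf_incl k = g.
Proof.
move=> Pg; unshelve eexists.
  refine (@SheafHom X Z subsheaf (fun U z => exist _ (g U z) (Pg U z)) _).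
  by move=> U V VU s; apply: sig_eq; rewrite /= sheaf_app_res.
exact: sheaf_hom_eq.
Qed.
End Subsheaf.

Section Prod.
Variables F G : sheaf X.

Definition prod_presheaf : presheaf X.
Proof.
refine (@Presheaf X (fun U => (F U * G U)%type)
  (fun U V VU s => (res VU s.1, res VU s.2)) _ _).
- by move=> U UU [s t]; rewrite /= !res_id.
- by move=> U V W VU WV WU s; rewrite /= !(res_comp VU WV WU).
Defined.

Lemma prod_is_sheaf : is_sheaf prod_presheaf.
Proof.
move=> V I U UV cov s cmp.
have cmp1 : compatible (fun i => (s i).1).
  by move=> i j; have := congr1 fst (cmp i j).
have cmp2 : compatible (fun i => (s i).2).
  by move=> i j; have := congr1 snd (cmp i j).
have [t [tE tu]] := sheafP UV cov cmp1.
have [r [rE ru]] := sheafP UV cov cmp2.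
exists (t, r); split=> [i|[t' r'] E]; first by rewrite /= tE rE; case: (s i).
by congr (_, _); [apply: tu|apply: ru] => i; rewrite -E.
Qed.

Definition prod_sheaf : Sh X := Sheaf prod_is_sheaf.

Definition sh_fst : sheaf_hom prod_sheaf F.
Proof. by refine (@SheafHom X prod_sheaf F (fun U s => s.1) _). Defined.

Definition sh_snd : sheaf_hom prod_sheaf G.
Proof. by refine (@SheafHom X prod_sheaf G (fun U s => s.2) _). Defined.

Definition sh_pair (Z : sheaf X) (f : sheaf_hom Z F) (g : sheaf_hom Z G) :
  sheaf_hom Z prod_sheaf.
Proof.
refine (@SheafHom X Z prod_sheaf (fun U s => (f U s, g U s)) _).
by move=> U V VU s; rewrite /= !sheaf_app_res.
Defined.

Lemma prod_sheafP :
  is_product (C := Sh X)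
    (sh_fst : hom prod_sheaf F) (sh_snd : hom prod_sheaf G).
Proof.
move=> Z f g; exists (sh_pair f g); split=> [|h [hf hg]].
  by split; apply: sheaf_hom_eq.
apply: sheaf_hom_eq => U s /=; rewrite -hf -hg /=; by case: (sheaf_app h s).
Qed.
End Prod.

Definition one_presheaf : presheaf X :=
  @Presheaf X (fun=> unit) (fun _ _ _ s => s)
    (fun _ _ _ => erefl) (fun _ _ _ _ _ _ _ => erefl).

Lemma one_is_sheaf : is_sheaf one_presheaf.
Proof.
by move=> V I U UV cov s cmp; exists tt; split=> [i|[]//]; case: (s i).
Qed.

Definition one_sheaf : Sh X := Sheaf one_is_sheaf.

Lemma one_terminal : is_terminal one_sheaf.
Proof.
move=> Z.
exists (@SheafHom X Z one_sheaf (fun _ _ => tt) (fun _ _ _ _ => erefl)).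
by split=> // h _; apply: sheaf_hom_eq => U s; case: (sheaf_app h s).
Qed.

Lemma sh_has_finite_limits : has_finite_limits (Sh X).
Proof.
split; first by exists one_sheaf; apply: one_terminal.
move=> A B D f g.
pose P U (p : prod_sheaf A B U) := f U p.1 = g U p.2.
have Pres (U V : opens X) (VU : V `<=` U) (p : prod_sheaf A B U) :
    P U p -> P V (res VU p).
  by rewrite /P /= !sheaf_app_res => ->.
have Ploc (V : opens X) (p : prod_sheaf A B V) :
    (forall x, x \at V -> exists (W : opens X) (WV : W `<=` V),
       x \at W /\ P W (res WV p)) -> P V p.
  move=> h; apply: sheaf_sep => x /h [W [WV [Wx]]]; rewrite /P /= => e.
  by exists W, WV; split=> //; rewrite -!sheaf_app_res.
pose S : Sh X := subsheaf Pres Ploc.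
pose i : hom S (prod_sheaf A B) := subsheaf_incl Pres Ploc.
exists S, ((sh_fst A B : hom _ (A : Sh X)) \oc i).
exists ((sh_snd A B : hom _ (B : Sh X)) \oc i).
split; first by apply: sheaf_hom_eq => U [p pP].
move=> Z z1 z2 e.
have [k kE] := @subsheaf_lift _ _ Pres Ploc Z (sh_pair z1 z2)
  (fun U z => congr1 (fun h : sheaf_hom Z D => h U z) e).
exists k; split=> [|k' [e1 e2]].
  by split; apply: sheaf_hom_eq => U z;
    have := congr1 (fun h : sheaf_hom _ _ => h U z) kE => /= ->.
apply: sheaf_hom_eq => U z; apply: sig_eq.
have := congr1 (fun h : sheaf_hom _ _ => h U z) kE => /= ->.
by rewrite -e1 -e2 /=; case: (sval _).
Qed.

End Sheaves.

(** * Exponentials of sheaves *)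

Section Exponential.
Variable X : topologicalType.
Variables A B : Sh X.

(** Restriction to [V] of the maps [yo U x A -> B], which are the sections over [U]
    of the exponential. *)
Definition exp_res (U V : opens X) (VU : V `<=` U)
  (h : sheaf_hom (prod_sheaf (yo U) A) B) : sheaf_hom (prod_sheaf (yo V) A) B.
Proof.
refine (@SheafHom X (prod_sheaf (yo V) A) B
  (fun W p => h W (subset_trans (p.1 : W `<=` V) VU, p.2)) _).
move=> W W' W'W [WV a] /=; rewrite -sheaf_app_res /=.
by congr (h W' (_, _)); apply: subset_irr.
Defined.

Definition exp_presheaf : presheaf X.
Proof.
refine (@Presheaf X (fun U => sheaf_hom (prod_sheaf (yo U) A) B) exp_res _ _).
- move=> U UU h; apply: sheaf_hom_eq => W [WU a] /=.
  by congr (h W (_, _)); apply: subset_irr.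
- move=> U V W VU WV WU h; apply: sheaf_hom_eq => W' [W'W a] /=.
  by congr (h W' (_, _)); apply: subset_irr.
Defined.

(** The value of the glued map at [a] is itself glued, from the values of the
    given maps on the restrictions of [a] to the opens of the cover. *)
Lemma exp_is_sheaf : is_sheaf exp_presheaf.
Proof.
move=> V I U UV cov h cmp.
have hE i j (W : opens X) (Wi : W `<=` U i) (Wj : W `<=` U j) (a : A W) :
    h i W (Wi, a) = h j W (Wj, a).
  have Wij : W `<=` openI_opens (U i) (U j).
    by move=> x Wx; split; [apply: Wi|apply: Wj].
  have := congr1 (fun g : sheaf_hom (prod_sheaf (yo _) A) B => g W (Wij, a))
    (cmp i j).
  by rewrite /= (subset_irr Wi (subset_trans Wij (@subIsetl _ _ _)))
   (subset_irr Wj (subset_trans Wij (@subIsetr _ _ _))).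
pose P (W : opens X) (a : A W) (W' : opens X) (b : B W') :=
  exists i (W'U : W' `<=` U i) (W'W : W' `<=` W), b = h i W' (W'U, res W'W a).
have Pglue (W : opens X) (WV : W `<=` V) (a : A W) : exists b : B W,
    forall W' (b' : B W') (W'W : W' `<=` W), P W a W' b' -> res W'W b = b'.
  apply: sheaf_glue.
  - move=> W1 W2 W21 b [i [W1U [W1W ->]]].
    exists i, (subset_trans W21 W1U), (subset_trans W21 W1W).
    by rewrite -sheaf_app_res /= res_resE.
  - move=> W' b b' [i [Wi [W'W ->]]] [j [Wj [W'W' ->]]].
    by rewrite (res_irr W'W' W'W); apply: hE.
  - move=> x Wx; have [i _ Ux] : (\bigcup_i U i) x by rewrite -cov; apply: WV.
    exists (openI_opens W (U i)).
    exists (h i (openI_opens W (U i)) (@openIr _ _ _, res (@openIl _ _ _) a)).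
    split; [exact: openIl|by []|].
    by exists i, (@openIr _ _ _), (@openIl _ _ _).
have [t0 t0P] := choice_fun
  (fun p : {W : opens X & ((W `<=` V) * A W)%type} =>
     Pglue (projT1 p) (projT2 p).1 (projT2 p).2).
pose t (W : opens X) (WV : W `<=` V) (a : A W) : B W := t0 (existT _ W (WV, a)).
have tP (W : opens X) (WV : W `<=` V) (a : A W) i (W' : opens X)
    (W'U : W' `<=` U i) (W'W : W' `<=` W) :
    res W'W (t W WV a) = h i W' (W'U, res W'W a).
  apply: (t0P (existT _ W (WV, a)) W' _ W'W).
  by exists i, W'U, W'W.
have tres (W W' : opens X) (W'W : W' `<=` W) (p : prod_sheaf (yo V) A W) :
    t W' (res W'W p).1 (res W'W p).2 = res W'W (t W p.1 p.2).
  case: p => WV a /=; apply: sheaf_sep => x W'x.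
  have [i _ Ux] : (\bigcup_i U i) x by rewrite -cov; apply/WV/W'W.
  exists (openI_opens W' (U i)), (@openIl _ _ _); split=> //.
  by rewrite res_resE !(tP _ _ _ i _ (@openIr _ _ _)) res_resE.
exists (@SheafHom X (prod_sheaf (yo V) A) B
  (fun W p => t W p.1 p.2) tres : exp_presheaf V).
split=> [i|g gE]; apply: sheaf_hom_eq => W [WU a] /=.
  pose WV : W `<=` V := subset_trans (WU : W `<=` U i) (UV i).
  have := tP W WV a i W WU (@subset_refl _ _).
  by rewrite !res_id.
apply: sheaf_sep => x Wx.
have [i _ Ux] : (\bigcup_i U i) x by rewrite -cov; apply: WU.
exists (openI_opens W (U i)), (@openIl _ _ _); split=> //.
rewrite (tP _ _ _ i _ (@openIr _ _ _)) -(gE i) -sheaf_app_res /=.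
by congr (sheaf_app g (_, _)); apply: subset_irr.
Qed.

Definition exp_sheaf : Sh X := Sheaf exp_is_sheaf.

Definition exp_ev : sheaf_hom (prod_sheaf exp_sheaf A) B.
Proof.
refine (@SheafHom X (prod_sheaf exp_sheaf A) B
  (fun U p => (p.1 : sheaf_hom (prod_sheaf (yo U) A) B) U
     (@subset_refl _ _, p.2)) _).
move=> U V VU [h a] /=; rewrite -sheaf_app_res /=.
by congr (sheaf_app h (_, _)); apply: subset_irr.
Defined.

Lemma exp_appE (Z : sheaf X) (u : sheaf_hom Z exp_sheaf) (U V : opens X)
    (z : Z U) (VU : V `<=` U) (a : A V) :
  (u U z : sheaf_hom (prod_sheaf (yo U) A) B) V (VU, a) =
  exp_ev V (u V (res VU z), a).
Proof.
rewrite /= sheaf_app_res /=.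
by congr (sheaf_app (sheaf_app u z) (_, _)); apply: subset_irr.
Qed.

Lemma exp_transpose (Z : sheaf X) (g : sheaf_hom (prod_sheaf Z A) B) :
  exists u : sheaf_hom Z exp_sheaf,
  forall U (z : Z U) (a : A U), exp_ev U (u U z, a) = g U (z, a).
Proof.
pose app U (z : Z U) : sheaf_hom (prod_sheaf (yo U) A) B :=
  sheaf_comp g
    (sh_pair (sheaf_comp (sec z) (sh_fst (yo U) A)) (sh_snd (yo U) A)).
unshelve eexists.
  refine (@SheafHom X Z exp_sheaf app _).
  move=> U V VU z; apply: sheaf_hom_eq => W [WV a] /=.
  by rewrite res_resE.
by move=> U z a; rewrite /= res_id.
Qed.

Lemma sh_exponential :
  is_exponential (C := Sh X)
    (sh_fst exp_sheaf A : hom (prod_sheaf exp_sheaf A) exp_sheaf)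
    (sh_snd exp_sheaf A : hom (prod_sheaf exp_sheaf A) A) (exp_ev : hom _ B).
Proof.
split; first exact: prod_sheafP.
move=> Z Q q1 q2 Qp g.
have [k0 [[k01 k02] _]] := Qp _ (sh_fst Z A : hom (prod_sheaf Z A) Z)
  (sh_snd Z A : hom (prod_sheaf Z A) A).
have k0K : k0 \oc (sh_pair q1 q2 : hom Q (prod_sheaf Z A)) = idm Q.
  have [k [_ ku]] := Qp _ q1 q2.
  rewrite -(ku (idm Q)) ?comp_idr //; symmetry; apply: ku.
  by rewrite !comp_assoc k01 k02; split; apply: sheaf_hom_eq.
have [u uP] := exp_transpose (g \oc k0 : hom (prod_sheaf Z A) B).
have k0E U (z : Z U) (a : A U) :
    q1 U (k0 U (z, a)) = z /\ q2 U (k0 U (z, a)) = a.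
  split.
    exact: (congr1 (fun h : sheaf_hom (prod_sheaf Z A) Z => h U (z, a)) k01).
  exact: (congr1 (fun h : sheaf_hom (prod_sheaf Z A) A => h U (z, a)) k02).
exists (u : hom Z exp_sheaf); split.
  exists (sh_pair ((u : hom Z exp_sheaf) \oc q1) q2).
  split; try exact: sheaf_hom_eq.
  apply: sheaf_hom_eq => U c; have /= := uP U (q1 U c) (q2 U c) => ->.
  by have := congr1 (fun h : sheaf_hom Q Q => h U c) k0K => /= ->.
move=> u' [k [k1 k2 k3]]; apply: sheaf_hom_eq => U z.
apply: sheaf_hom_eq => V [VU a]; rewrite !exp_appE uP.
have [e1 e2] := k0E V (res VU z) a.
have -> : (u' V (res VU z), a) = k V (k0 V (res VU z, a)).
  rewrite [RHS]surjective_pairing.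
  have /= -> := congr1
    (fun h : sheaf_hom Q exp_sheaf => h V (k0 V (res VU z, a))) k1.
  have /= -> := congr1 (fun h : sheaf_hom Q A => h V (k0 V (res VU z, a))) k2.
  by rewrite e1 e2.
by have /= <- := congr1 (fun h : sheaf_hom Q B => h V (k0 V (res VU z, a))) k3.
Qed.
End Exponential.

(** * The subobject classifier of sheaves *)

Section Classifier.
Variable X : topologicalType.

(** The sections over [U] are the opens contained in [U]; restriction is
    intersection. *)
Definition Omega_presheaf : presheaf X.
Proof.
refine (@Presheaf X (fun U => {W : set X | open W /\ W `<=` U})
  (fun U V VU s => exist _ (sval s `&` V)
     (conj (openI (svalP s).1 (svalP V)) (@subIsetr _ _ _))) _ _).
- by move=> U UU [W [oW WU]]; apply: sig_eq => /=; apply: setIidl.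
- move=> U V W VU WV WU s; apply: sig_eq => /=.
  by rewrite -setIA (setIidr WV).
Defined.

Lemma Omega_is_sheaf : is_sheaf Omega_presheaf.
Proof.
move=> V I U UV cov s cmp.
have sE i j x : x \at U j -> sval (s i) x -> sval (s j) x.
  move=> Ujx six; have Uix : x \at U i := (svalP (s i)).2 x six.
  have /(congr1 (fun A : set X => A x)) := congr1 sval (cmp i j).
  rewrite /= /setI /= => e.
  by have [] : sval (s j) x /\ (x \at U i /\ x \at U j) by rewrite -e.
pose W := \bigcup_i sval (s i).
have oW : open W by apply: bigcup_open => i _; apply: (svalP (s i)).1.
have WV : W `<=` V by move=> x [i _ six]; apply/(UV i)/(svalP (s i)).2.
exists (exist _ W (conj oW WV)); split=> [i|[W' [oW' W'V]] E].
  apply: sig_eq; apply/seteqP; split=> [x /= [[j _ sjx] Ux]|x /= six].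
    exact: sE sjx.
  by split; [exists i|apply: (svalP (s i)).2].
apply: sig_eq; apply/seteqP; split=> [x /= [i _]|x W'x].
  by rewrite -E => -[].
have [i _ Ux] : (\bigcup_i U i) x by rewrite -cov; exact: (W'V x W'x).
by exists i => //; rewrite -E.
Qed.

Definition Omega : Sh X := Sheaf Omega_is_sheaf.

Definition Omega_true : sheaf_hom (one_sheaf X) Omega.
Proof.
refine (@SheafHom X (one_sheaf X) Omega
  (fun U _ => exist _ (U : set X) (conj (svalP U) (@subset_refl _ _))) _).
by move=> U V VU s; apply: sig_eq; rewrite /= setIidr.
Defined.

Section Char.
Variables (S A : Sh X) (m : hom S A).
Hypothesis mm : is_mono m.

Lemma in_image_local (U : opens X) (a : A U) :
  (forall x, x \at U -> exists (V : opens X) (VU : V `<=` U),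
     x \at V /\ exists s, m V s = res VU a) ->
  exists s, m U s = a.
Proof.
move=> h.
have [|W s t|x Ux|s sP] := @sheaf_glue _ S U
    (fun V s => exists VU : V `<=` U, m V s = res VU a).
- move=> W W' W'W s [WU e]; exists (subset_trans W'W WU).
  by rewrite sheaf_app_res e res_resE.
- move=> [WU e] [WU' e']; apply: sh_mono_inj mm _.
  by rewrite e e'; apply: res_irr.
- by have [V [VU [Vx [s e]]]] := h x Ux; exists V, s; split=> //; exists VU.
exists s; apply: sheaf_sep => x Ux; have [V [VU [Vx [s' e]]]] := h x Ux.
exists V, VU; split=> //.
by rewrite -sheaf_app_res (sP _ s') //; exists VU.
Qed.

(** The largest open on which [a] belongs locally to the image of [m]. *)
Definition char_set (U : opens X) (a : A U) : set X :=
  [set x | exists (V : opens X) (VU : V `<=` U),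
     x \at V /\ exists s, m V s = res VU a].

Lemma char_set_prop (U : opens X) (a : A U) :
  open (char_set a) /\ char_set a `<=` U.
Proof.
split=> [|x [V [VU [Vx _]]]]; last exact: VU.
apply: open_local => x [V [VU [Vx h]]]; exists V; split=> // y Vy.
by exists V, VU.
Qed.

Definition char : sheaf_hom A Omega.
Proof.
refine (@SheafHom X A Omega
  (fun U a => exist _ (char_set a) (char_set_prop a)) _).
move=> U V VU a; apply: sig_eq; apply/seteqP; split=> [x [W [WV [Wx [s e]]]]|x].
  split; last exact: (WV x Wx).
  by exists W, (subset_trans WV VU); split=> //; exists s; rewrite e res_resE.
move=> [[W [WU [Wx [s e]]]] Vx].
exists (openI_opens W V), (@openIr _ _ _); split=> //.
exists (res (@openIl _ _ _) s).
by rewrite sheaf_app_res e; apply: res_comm.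
Defined.

(** By injectivity of [m], local preimages of [a] glue. *)
Lemma charP (U : opens X) (a : A U) :
  sval (char U a) = U <-> exists s, m U s = a.
Proof.
split=> [e|[s e]].
  by apply: in_image_local => x Ux; have : sval (char U a) x by rewrite e.
apply/seteqP; split=> [x [V [VU [Vx _]]]|x Ux]; first exact: VU.
by exists U, (@subset_refl _ _); split=> //; exists s; rewrite res_id.
Qed.

Lemma sh_lift (Z : Sh X) (z : hom Z A) :
  (forall U c, exists s, m U s = z U c) -> exists k : hom Z S, m \oc k = z.
Proof.
move=> h.
have [k kE] := choice_fun
  (fun p : {U : opens X & Z U} => h (projT1 p) (projT2 p)).
unshelve eexists.
  refine (@SheafHom X Z S (fun U c => k (existT _ U c)) _).
  move=> U V VU c; apply: sh_mono_inj mm _.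
  rewrite sheaf_app_res (kE (existT _ U c)) (kE (existT _ V _)) /=.
  by rewrite sheaf_app_res.
by apply: sheaf_hom_eq => U c; rewrite /= (kE (existT _ U c)).
Qed.
End Char.

Lemma sh_subobject_classifier :
  is_subobject_classifier (Omega_true : hom (one_sheaf X) Omega).
Proof.
split; first exact: one_terminal.
move=> S A m mm; exists (char m : hom A Omega).
have [t [_ tu]] := @one_terminal X S.
split.
  exists t; split.
    apply: sheaf_hom_eq => U s; apply: sig_eq.
    by apply/(charP mm (m U s)); exists s.
  move=> Z z1 z2 e.
  have [|k kE] := sh_lift mm (z := z1).
    move=> U c; apply/(charP mm).
    by have := congr1 (fun g : sheaf_hom Z Omega => sval (g U c)) e.
  exists k; split=> [|k' [e1 _]]; last by apply: mm; rewrite e1.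
  split=> //.
  by have [r [_ ru]] := @one_terminal X Z; rewrite -(ru z2) // -(ru (t \oc k)).
move=> chi [t' [comm pb]]; apply: sheaf_hom_eq => U a.
(* The pullback property at the map [sec b] determines where [chi V b] is
   the whole of [V]; a section of [Omega] is determined by this on all
   restrictions. *)
have chiP (V : opens X) (b : A V) : sval (chi V b) = V <-> exists s, m V s = b.
  split=> [e|[s <-]]; last first.
    by have := congr1 (fun g : sheaf_hom S Omega => sval (g V s)) comm.
  have [r [_ _]] := @one_terminal X (yo V).
  have [|k [[kE _] _]] := pb (yo V) (sec b) r.
    apply: sheaf_hom_eq => W WV; apply: sig_eq => /=.
    by rewrite sheaf_app_res /= e setIidr.
  exists (k V (@subset_refl _ _)).
  have := congr1 (fun g : sheaf_hom (yo V) A => g V (@subset_refl _ _)) kE.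
  by rewrite /= res_id.
apply: sig_eq; apply/seteqP; split=> [x [V [VU [Vx]]]|x cx].
  move/chiP; rewrite sheaf_app_res /= => e.
  by have : x \at V := Vx; rewrite -[opens_set V]e => -[].
have [ocx cU] := svalP (chi U a).
exists (exist _ _ ocx), cU; split=> //; apply/chiP.
by rewrite sheaf_app_res /= setIid.
Qed.

Lemma sh_elementary_topos : elementary_topos (Sh X).
Proof.
split; first exact: sh_has_finite_limits.
  move=> A B; exists (exp_sheaf A B), (prod_sheaf (exp_sheaf A B) A).
  by exists (sh_fst _ _), (sh_snd _ _), (exp_ev A B); apply: sh_exponential.
by exists (one_sheaf X), Omega, Omega_true; apply: sh_subobject_classifier.
Qed.
End Classifier.

(** * Finite limits and power objects in an elementary topos *)

Section Limits.
Variable C : category.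
Hypothesis lims : has_finite_limits C.

Lemma product_exists (A B : C) :
  exists (P : C) (p1 : hom P A) (p2 : hom P B), is_product p1 p2.
Proof.
have [[T Tt] pb] := lims.
have [a _] := Tt A; have [b _] := Tt B.
have [P [p1 [p2 [_ pbP]]]] := pb A B T a b.
exists P, p1, p2 => Z z1 z2; apply: pbP.
by have [t [_ tu]] := Tt Z; rewrite -(tu (a \oc z1)) // -(tu (b \oc z2)).
Qed.

Lemma product_joint (A B P : C) (p1 : hom P A) (p2 : hom P B) :
  is_product p1 p2 -> forall (Z : C) (u v : hom Z P),
  p1 \oc u = p1 \oc v -> p2 \oc u = p2 \oc v -> u = v.
Proof.
move=> PP Z u v e1 e2; have [w [_ wu]] := PP Z (p1 \oc v) (p2 \oc v).
by rewrite -(wu u) // -(wu v).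
Qed.

Lemma equalizer_exists (A B : C) (f g : hom A B) :
  exists (E : C) (e : hom E A), is_mono e /\
    forall (Z : C) (z : hom Z A), f \oc z = g \oc z <-> exists k, z = e \oc k.
Proof.
have [P [p1 [p2 PP]]] := product_exists B B.
have joint := product_joint PP.
have [fg [[fg1 fg2] _]] := PP A f g.
have [d [[d1 d2] _]] := PP B (idm B) (idm B).
have [E [e [e' [comm pb]]]] := lims.2 _ _ _ fg d.
have fe : f \oc e = e' by rewrite -fg1 -comp_assoc comm comp_assoc d1 comp_idl.
exists E, e; split=> [Z u v uv|Z z].
  have [|w [_ wu]] := pb Z (e \oc v) (e' \oc v).
    by rewrite !comp_assoc comm.
  by rewrite -(wu u) ?(wu v) // -fe -!comp_assoc uv.
split=> [eq|[k ->]].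
  have [|k [[k1 _] _]] := pb Z z (f \oc z); last by exists k.
  by apply: joint; rewrite !comp_assoc ?fg1 ?fg2 ?d1 ?d2 comp_idl.
rewrite !comp_assoc; congr (_ \oc _).
by rewrite fe -fg2 -comp_assoc comm comp_assoc d2 comp_idl.
Qed.

Lemma split_mono_iso (A B : C) (m : hom A B) (s : hom B A) :
  is_mono m -> m \oc s = idm B -> is_iso m.
Proof.
move=> mm ms; exists s; split=> //; apply: mm.
by rewrite comp_assoc ms comp_idl comp_idr.
Qed.

Lemma pullback_joint (A B D P : C) (f : hom A D) (g : hom B D) (p1 : hom P A)
    (p2 : hom P B) (Z : C) (u v : hom Z P) :
  is_pullback f g p1 p2 -> p1 \oc u = p1 \oc v -> p2 \oc u = p2 \oc v -> u = v.
Proof.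
move=> [comm pb] e1 e2; have [|w [_ wu]] := pb Z (p1 \oc v) (p2 \oc v).
  by rewrite !comp_assoc comm.
by rewrite -(wu u) // -(wu v).
Qed.

End Limits.

Section Power.
Variable C : category.
Hypothesis topC : elementary_topos C.

(** A power object of [K], in terms of generalized elements: [mem] is a relation
    between the maps to [K] and the maps to [PK] that makes [Z -> PK] classify the
    subobjects of [K x Z].  These are given by jointly monic pairs [r1, r2], which
    avoids a choice of products.  [mem_sub] says that [mem] is represented by a
    subobject of [Z] for every [x : Z -> K] and [t : Z -> PK]. *)
Record power_object (K PK : C)
    (mem : forall W : C, hom W K -> hom W PK -> Prop) : Prop := PowerObject {
  mem_ext : forall (Z : C) (u u' : hom Z PK),
    (forall (W : C) (x : hom W K) (z : hom W Z),
       mem W x (u \oc z) <-> mem W x (u' \oc z)) -> u = u';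
  mem_name : forall (Z S : C) (r1 : hom S K) (r2 : hom S Z),
    (forall (W : C) (g h : hom W S),
       r1 \oc g = r1 \oc h -> r2 \oc g = r2 \oc h -> g = h) ->
    exists u : hom Z PK, forall (W : C) (x : hom W K) (z : hom W Z),
      mem W x (u \oc z) <-> exists s, x = r1 \oc s /\ z = r2 \oc s;
  mem_sub : forall (Z : C) (x : hom Z K) (t : hom Z PK),
    exists (S : C) (m : hom S Z), is_mono m /\
    forall (W : C) (w : hom W Z),
      mem W (x \oc w) (t \oc w) <-> exists s, w = m \oc s
}.

(** [PK] is the exponential [Omega ^ K], and [mem x y] says that the value of [y]
    at [x] is true. *)
Lemma power_object_exists (K : C) :
  exists PK (mem : forall W : C, hom W K -> hom W PK -> Prop), power_object mem.
Proof.
have [lims expo [T [Om [tr [Tt cl]]]]] := topC.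
have [PK [P [p1 [p2 [ev [PP evP]]]]]] := expo K Om.
pose tt (W : C) (w : hom W Om) := exists t : hom W T, w = tr \oc t.
have Tuniq (W : C) (s t : hom W T) : s = t.
  by have [r [_ ru]] := Tt W; rewrite -(ru s) // -(ru t).
have tr_mono : is_mono tr by move=> *; apply: Tuniq.
have sub (Z : C) (c : hom Z Om) : exists (S : C) (m : hom S Z) (t : hom S T),
    [/\ is_mono m, is_pullback c tr m t &
      forall (W : C) (w : hom W Z), tt W (c \oc w) <-> exists s, w = m \oc s].
  have [S [m [t pb]]] := lims.2 _ _ _ c tr.
  exists S, m, t; split=> //.
    by move=> W g h e; apply: pullback_joint pb e _; apply: Tuniq.
  move=> W w; split=> [[r e]|[s ->]].
    by have [s [[<- _] _]] := pb.2 W w r e; exists s.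
  by exists (t \oc s); rewrite !comp_assoc pb.1.
(* Maps to [Omega] are determined by the generalized elements they send to
   truth. *)
have omext (Z : C) (c c' : hom Z Om) :
    (forall (W : C) (w : hom W Z), tt W (c \oc w) <-> tt W (c' \oc w)) ->
    c = c'.
  move=> h; have [S [m [t [mm pb cP]]]] := sub Z c.
  have [x [_ xu]] := cl _ _ m mm.
  rewrite -(xu c); last by exists t.
  apply: xu; exists t; split.
    have /h [r e] : tt S (c \oc m).
      by apply/cP; exists (idm S); rewrite comp_idr.
    by rewrite e (Tuniq _ r t).
  move=> W z1 z2 e; have : tt W (c' \oc z1) by exists z2.
  move=> /h [r e'].
  by apply: pb.2; rewrite e' (Tuniq _ r z2).
have char (Z S : C) (m : hom S Z) : is_mono m -> exists c : hom Z Om,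
    forall (W : C) (w : hom W Z), tt W (c \oc w) <-> exists s, w = m \oc s.
  move=> mm; have [c [[t pb] _]] := cl _ _ m mm.
  exists c => W w; split=> [[r e]|[s ->]].
    by have [s [[<- _] _]] := pb.2 W w r e; exists s.
  by exists (t \oc s); rewrite !comp_assoc pb.1.
have pairE (W : C) (y : hom W PK) (x : hom W K) :
  exists q, p1 \oc q = y /\ p2 \oc q = x.
  by have [q [? _]] := PP W y x; exists q.
have joint := product_joint PP.
pose mem (W : C) (x : hom W K) (y : hom W PK) :=
  exists q : hom W P, [/\ p1 \oc q = y, p2 \oc q = x & tt W (ev \oc q)].
have memE (W : C) (q : hom W P) :
    mem W (p2 \oc q) (p1 \oc q) <-> tt W (ev \oc q).
  split=> [[q' [e1 e2]]|h]; last by exists q.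
  by rewrite (joint _ _ _ e1 e2).
exists PK, mem; split.
- move=> Z u u' h.
  have [Q [q1 [q2 QP]]] := product_exists lims Z K.
  have [k [k1 k2]] := pairE Q (u \oc q1) q2.
  have [k' [k1' k2']] := pairE Q (u' \oc q1) q2.
  have e : ev \oc k = ev \oc k'.
    apply: omext => W w; rewrite -!comp_assoc -!memE !comp_assoc k1 k2 k1' k2'.
    by rewrite -!comp_assoc.
  have [v [_ vu]] := evP Z Q q1 q2 QP (ev \oc k).
  by rewrite -(vu u) ?(vu u') //; [exists k'|exists k].
- move=> Z S r1 r2 jm.
  have [Q [q1 [q2 QP]]] := product_exists lims Z K.
  have [m [[m1 m2] _]] := QP S r2 r1.
  have mm : is_mono m.
    by move=> W g h e; apply: jm; rewrite -?m1 -?m2 -!comp_assoc e.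
  have [c cP] := char _ _ m mm.
  have [u [[k [k1 k2 kc]] _]] := evP Z Q q1 q2 QP c.
  exists u => W x z; have [w [[w1 w2] wu]] := QP W z x.
  rewrite -w1 -w2 comp_assoc -k1 -[in q2 \oc w]k2 -!comp_assoc memE.
  rewrite comp_assoc kc cP.
  split=> [[s ->]|[s [e1 e2]]].
    by exists s; rewrite !comp_assoc m1 k2 m2.
  exists s; apply: wu; rewrite !comp_assoc m1 m2 -e2.
  by rewrite -e1 [p2 \oc _]comp_assoc k2 w1.
- move=> Z x t; have [q [<- <-]] := pairE Z t x.
  have [S [m [_ [mm _ sP]]]] := sub Z (ev \oc q).
  by exists S, m; split=> // W w; rewrite -sP -!comp_assoc memE.
Qed.

End Power.

(** * Covering families under an inverse image functor *)

Section Transpose.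
Variables (C D : category) (L : functor C D) (R : functor D C).
Variable adj : adjunction L R.

Lemma transp_precomp (A A' : C) (B : D) (a : hom A' A) (f : hom (L A) B) :
  transp adj (f \oc fmap L a) = transp adj f \oc a.
Proof.
by have := transp_nat adj a (idm B) f; rewrite fmap_id !comp_idl.
Qed.

Lemma transp_postcomp (A : C) (B B' : D) (b : hom B B') (f : hom (L A) B) :
  transp adj (b \oc f) = fmap R b \oc transp adj f.
Proof.
by have := transp_nat adj (idm A) b f; rewrite fmap_id !comp_idr.
Qed.

Lemma transp_inj (A : C) (B : D) (f g : hom (L A) B) :
  transp adj f = transp adj g -> f = g.
Proof. by move=> e; rewrite -(transpK adj f) e transpK. Qed.

(** The unit of the adjunction. *)
Definition unit (A : C) : hom A (R (L A)) := transp adj (idm (L A)).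

Lemma transpE (A : C) (B : D) (f : hom (L A) B) :
  transp adj f = fmap R f \oc unit A.
Proof. by rewrite -transp_postcomp comp_idr. Qed.

End Transpose.

Definition jointly_epic (C : category) (A : C) (I : Type) (A_ : I -> C)
    (a : forall i, hom (A_ i) A) : Prop :=
  forall (N : C) (g h : hom A N), (forall i, g \oc a i = h \oc a i) -> g = h.

(** Compatible families on the [A_ i] glue to maps on [A], uniquely.  Compatibility
    is tested on all the commutative squares over [A], so that fibre products need
    not be chosen. *)
Definition effective_epic (C : category) (A : C) (I : Type) (A_ : I -> C)
    (a : forall i, hom (A_ i) A) : Prop :=
  jointly_epic a /\
  forall (N : C) (n : forall i, hom (A_ i) N),
    (forall (Z : C) i j (z : hom Z (A_ i)) (z' : hom Z (A_ j)),
       a i \oc z = a j \oc z' -> n i \oc z = n j \oc z') ->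
    exists n0 : hom A N, forall i, n0 \oc a i = n i.

Section Universal.
Variables (F E : category) (gm : geometric_morphism F E).
Hypothesis topF : elementary_topos F.
Notation fs := (inverse_image gm).
Notation adj := (inverse_direct_adj gm).
Variables (A : E) (I : Type) (A_ : I -> E) (a : forall i, hom (A_ i) A).

Lemma inverse_image_epic :
  jointly_epic a -> jointly_epic (fun i => fmap fs (a i)).
Proof.
move=> je N g h e; apply: (transp_inj (adj := adj)); apply: je => i.
by rewrite -!transp_precomp e.
Qed.

Lemma inverse_image_glue (N : F) (n : forall i, hom (fs (A_ i)) N) :
  effective_epic a ->
  (forall (Z : E) i j (z : hom Z (A_ i)) (z' : hom Z (A_ j)),
       a i \oc z = a j \oc z' -> n i \oc fmap fs z = n j \oc fmap fs z') ->
  exists n0 : hom (fs A) N, forall i, n0 \oc fmap fs (a i) = n i.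
Proof.
move=> [_ ee] cmp; have [|n0 n0E] := ee _ (fun i => transp adj (n i)).
  by move=> Z i j z z' /cmp e; rewrite -!transp_precomp e.
exists (untransp adj n0) => i; apply: (transp_inj (adj := adj)).
by rewrite transp_precomp untranspK.
Qed.

Section Epic.
Hypothesis je : jointly_epic a.

(** The cover of [A] is pulled back along [p : P -> f^* A]; instead of choosing
    pullbacks, one considers the sieve of all [w] with values in [P] such that
    [p \oc w = f^* (a i) \oc v] for some [i] and [v].  A subobject [m] of [P] through
    which this sieve factors is all of [P]: the graphs of [p] on [P] and on its
    subobject have names [f^* A -> PP], where [PP] is the power object of [P], and
    these names agree after composition with each [f^* (a i)]. *)
Lemma mono_local (P D : F) (p : hom P (fs A)) (m : hom D P) :
  is_mono m ->
  (forall i (W : F) (w : hom W P) (v : hom W (fs (A_ i))),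
     p \oc w = fmap fs (a i) \oc v -> exists s, w = m \oc s) ->
  exists s, m \oc s = idm P.
Proof.
move=> mm cov; have [PK [mem pow]] := power_object_exists topF P.
have [|u1 u1P] := mem_name pow (r1 := m) (r2 := p \oc m).
  by move=> W g h /mm.
have [|u2 u2P] := mem_name pow (r1 := idm P) (r2 := p).
  by move=> W g h; rewrite !comp_idl.
have u12 : u1 = u2.
  apply: (inverse_image_epic je) => i; apply: (mem_ext pow) => W x v.
  rewrite -!comp_assoc u1P u2P; split=> [[s [e1 e2]]|[s [e1 e2]]].
    by exists x; rewrite comp_idl e1 comp_assoc.
  rewrite comp_idl in e1; rewrite -e1 in e2.
  have [t e] := cov i W x v (esym e2).
  by exists t; rewrite e2 e comp_assoc.
have [_ /(_ (ex_intro _ (idm P) _))] := u2P P (idm P) p.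
rewrite comp_idl comp_idr => /(_ (conj erefl erefl)).
by rewrite -u12 => /u1P [s [e _]]; exists s.
Qed.

Lemma pullback_epic (P N : F) (p : hom P (fs A)) (g h : hom P N) :
  (forall i (W : F) (w : hom W P) (v : hom W (fs (A_ i))),
     p \oc w = fmap fs (a i) \oc v -> g \oc w = h \oc w) ->
  g = h.
Proof.
have [lims _ _] := topF; have [D [m [mm mP]]] := equalizer_exists lims g h.
move=> e; have [|s ms] := @mono_local P D p m mm.
  by move=> i W w v /e /mP.
rewrite -(comp_idr g) -(comp_idr h) -ms.
by apply/mP; exists s.
Qed.

End Epic.

Hypothesis ee : effective_epic a.

(** Gluing along the pulled back sieve.  The family to be glued is given by the
    relation [rel w n], which reads: the map to be found sends [w] to [n]. *)
Lemma pullback_glue (P N : F) (p : hom P (fs A))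
    (rel : forall W : F, hom W P -> hom W N -> Prop) :
  (forall (W W' : F) (k : hom W' W) (w : hom W P) (n : hom W N),
     rel W w n -> rel W' (w \oc k) (n \oc k)) ->
  (forall (W : F) (w : hom W P) (n n' : hom W N),
     rel W w n -> rel W w n' -> n = n') ->
  (forall i (W : F) (w : hom W P) (v : hom W (fs (A_ i))),
     p \oc w = fmap fs (a i) \oc v -> exists n, rel W w n) ->
  exists n : hom P N, forall i (W : F) (w : hom W P) (v : hom W (fs (A_ i))),
     p \oc w = fmap fs (a i) \oc v -> rel W w (n \oc w).
Proof.
move=> rnat rfun rtot; have [lims _ _] := topF.
have [K [k1 [k2 KP]]] := product_exists lims P N.
have kE (W : F) (w : hom W P) (n : hom W N) :
    exists k, k1 \oc k = w /\ k2 \oc k = n.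
  by have [k [? _]] := KP W w n; exists k.
have joint := product_joint KP.
have [PK [mem pow]] := power_object_exists topF K.
(* The graph of the partial map given over [a i], as a subobject of
   [K x f^* (A_ i)] with [K = P x N]. *)
have uex i : exists u : hom (fs (A_ i)) PK,
    forall (W : F) (x : hom W K) (v : hom W (fs (A_ i))),
    mem W x (u \oc v) <->
    p \oc (k1 \oc x) = fmap fs (a i) \oc v /\ rel W (k1 \oc x) (k2 \oc x).
  have [S [s1 [s2 pb]]] := lims.2 _ _ _ p (fmap fs (a i)).
  have [n rn] := rtot i S s1 s2 pb.1.
  have [r [r1 r2]] := kE S s1 n.
  have [|u uP] := mem_name pow (r1 := r) (r2 := s2).
    move=> W g h e1 e2; apply: pullback_joint pb _ e2.
    by rewrite -r1 -!comp_assoc e1.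
  exists u => W x v; rewrite uP; split=> [[s [-> ->]]|[e1 e2]].
    rewrite !comp_assoc -[p \oc _ \oc _]comp_assoc r1 r2 pb.1.
    by split=> //; apply: rnat.
  have [s [[sx sv] _]] := pb.2 W (k1 \oc x) v e1.
  exists s; split=> //; apply: joint; rewrite comp_assoc ?r1 ?sx ?r2 //.
  by apply: rfun e2 _; rewrite -sx; apply: rnat.
have [u uP] := choice_fun uex.
have [|u0 u0E] := inverse_image_glue (n := u) ee.
  move=> Z i j z z' e; apply: (mem_ext pow) => W x v.
  rewrite -!comp_assoc !uP !comp_assoc -!fmap_comp e.
  by [].
(* [G] is the candidate graph in [P x N]; it remains to see that it projects
   isomorphically to [P], which is local on [P]. *)
have [G [m [mm mP]]] := mem_sub pow (idm K) (u0 \oc (p \oc k1)).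
have mP' i (W : F) (x : hom W K) (v : hom W (fs (A_ i))) :
    p \oc (k1 \oc x) = fmap fs (a i) \oc v ->
    (exists s, x = m \oc s) <-> rel W (k1 \oc x) (k2 \oc x).
  move=> e; rewrite -mP comp_idl -!comp_assoc e comp_assoc u0E uP.
  by split=> [[]|].
have gm_mono : is_mono (k1 \oc m).
  move=> W g h; rewrite -!comp_assoc => e; apply: mm; apply: joint => //.
  apply: (pullback_epic ee.1 (p := p \oc (k1 \oc (m \oc g)))) => i W' w v.
  rewrite -!comp_assoc => e'.
  have h1 : rel W' (k1 \oc (m \oc (g \oc w))) (k2 \oc (m \oc (g \oc w))).
    by apply/(mP' i _ _ v e'); exists (g \oc w).
  have eg : k1 \oc (m \oc (g \oc w)) = k1 \oc (m \oc (h \oc w)).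
    by rewrite !comp_assoc -[k1 \oc m \oc g]comp_assoc e !comp_assoc.
  have h2 : rel W' (k1 \oc (m \oc (h \oc w))) (k2 \oc (m \oc (h \oc w))).
    by apply/(mP' i _ _ v); [rewrite -eg|exists (h \oc w)].
  by rewrite eg in h1; apply: rfun h1 h2.
have [|s ks] := mono_local ee.1 (p := p) gm_mono.
  move=> i W w v e; have [n rn] := rtot i W w v e.
  have [x [x1 x2]] := kE W w n.
  have ex : p \oc (k1 \oc x) = fmap fs (a i) \oc v by rewrite x1.
  have [|t te] := (mP' i W x v ex).2; first by rewrite x1 x2.
  by exists t; rewrite -comp_assoc -te x1.
exists (k2 \oc (m \oc s)) => i W w v e.
have e1 : k1 \oc (m \oc (s \oc w)) = w.
  by rewrite !comp_assoc ks comp_idl.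
have [|h _] := mP' i W (m \oc (s \oc w)) v; first by rewrite e1.
by rewrite e1 in h; rewrite -!comp_assoc; apply: h; exists (s \oc w).
Qed.

End Universal.

(** * Covers of sheaves and skyscrapers *)

Section Covers.
Variable X : topologicalType.

(** Every section of [A] comes locally from sections of the [A_ i]. *)
Definition locally_surjective (A : Sh X) (I : Type) (A_ : I -> Sh X)
    (a : forall i, hom (A_ i) A) : Prop :=
  forall (U : opens X) (s : A U) x, x \at U ->
    exists (W : opens X) (WU : W `<=` U) i (t : A_ i W),
      x \at W /\ a i W t = res WU s.

Lemma locally_surjective_effective (A : Sh X) (I : Type) (A_ : I -> Sh X)
    (a : forall i, hom (A_ i) A) :
  locally_surjective a -> effective_epic a.
Proof.
move=> ls; split=> [N g h e|N n cmp].
  apply: sheaf_hom_eq => U s; apply: sheaf_sep => x /(ls _ s).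
  move=> [W [WU [i [t [Wx tE]]]]]; exists W, WU; split=> //.
  rewrite -!sheaf_app_res -tE.
  exact: (congr1 (fun k : sheaf_hom (A_ i) N => k W t) (e i)).
have nE (W : opens X) i j (t : A_ i W) (t' : A_ j W) :
    a i W t = a j W t' -> n i W t = n j W t'.
  move=> e; apply: sec_inj; rewrite -!sec_comp; apply: cmp.
  by rewrite !sec_comp e.
have glue (p : {U : opens X & A U}) : exists b : N (projT1 p),
    forall (W : opens X) (WU : W `<=` projT1 p) i (t : A_ i W),
      a i W t = res WU (projT2 p) -> res WU b = n i W t.
  case: p => U s /=.
  have [|W b b'|x Ux|b bP] := @sheaf_glue _ N U (fun W b =>
      exists (WU : W `<=` U) i (t : A_ i W), a i W t = res WU s /\ b = n i W t).
  - move=> W W' W'W b [WU [i [t [e ->]]]].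
    exists (subset_trans W'W WU), i, (res W'W t).
    by rewrite !sheaf_app_res e res_resE.
  - move=> [WU [i [t [e ->]]]] [WU' [j [t' [e' ->]]]]; apply: nE.
    by rewrite e e'; apply: res_irr.
  - have [W [WU [i [t [Wx tE]]]]] := ls U s x Ux.
    by exists W, (n i W t); split=> //; exists WU, i, t.
  by exists b => W WU i t e; apply: bP; exists WU, i, t.
have [b bP] := choice_fun glue.
unshelve eexists.
  refine (@SheafHom X A N (fun U s => b (existT _ U s)) _).
  move=> U V VU s; apply: sheaf_sep => x Vx.
  have [W [WV [i [t [Wx tE]]]]] := ls V (res VU s) x Vx.
  exists W, WV; split=> //; rewrite res_resE.
  rewrite (bP (existT _ U s) W _ i t) ?tE ?res_resE //.
  by rewrite (bP (existT _ V (res VU s)) W _ i t) ?tE.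
move=> i; apply: sheaf_hom_eq => U t /=.
have := bP (existT _ U (a i U t)) U (@subset_refl _ _) i t.
by rewrite /= !res_id; apply.
Qed.

(** The family of all sections of [Q] over all opens. *)
Definition all_sections (Q : Sh X) (s : {U : opens X & Q U}) :
  hom (yo (projT1 s)) Q := sec (projT2 s).

Lemma all_sections_effective (Q : Sh X) : effective_epic (@all_sections Q).
Proof.
apply: locally_surjective_effective => U s x Ux.
exists U, (@subset_refl _ U), (existT _ U s), (@subset_refl _ U).
by rewrite /= !res_id.
Qed.

Variable x : X.

(** The skyscraper sheaf at [x] with stalk [Prop].  Its sections over [U] are the
    functions from the proposition that [x] lies in [U] to [Prop], so that there is
    exactly one section when [x] is not in [U]. *)
Definition sky_presheaf : presheaf X.
Proof.
refine (@Presheaf X (fun U => x \at U -> Prop)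
  (fun U V VU s Vx => s (VU x Vx)) _ _).
- by move=> U UU s; apply/funext => Vx; congr (s _); apply: Prop_irrelevance.
- move=> U V W VU WV WU s; apply/funext => Wx; congr (s _).
  exact: Prop_irrelevance.
Defined.

Lemma sky_is_sheaf : is_sheaf sky_presheaf.
Proof.
move=> V I U UV cov s cmp.
have sE i j (Ui : x \at U i) (Uj : x \at U j) : s i Ui = s j Uj.
  have := congr1 (fun g => g (conj Ui Uj)) (cmp i j) => /=.
  by congr (_ = _); congr (s _ _); apply: Prop_irrelevance.
exists (fun _ => exists i Ui, s i Ui); split=> [i|t tE].
  apply/funext => Ui /=; apply/propext; split=> [[j [Uj]]|h].
    by rewrite (sE j i Uj Ui).
  by exists i, Ui.
apply/funext => Vx; apply/propext.
have [i _ Ui] : (\bigcup_i U i) x by rewrite -cov.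
have e : t Vx = s i Ui by rewrite -tE /=; congr (t _); apply: Prop_irrelevance.
by rewrite e; split=> [[j [Uj]]|h]; [rewrite (sE j i Uj Ui)|exists i, Ui].
Qed.

Definition sky : Sh X := Sheaf sky_is_sheaf.

Lemma off_irr (U : opens X) (h h' : ~ x \at U) : h = h'.
Proof. exact: Prop_irrelevance. Qed.

(** The subterminal sheaf [off], with a section over [U] exactly when [U] avoids
    [x]. *)
Definition off_presheaf : presheaf X.
Proof.
by refine (@Presheaf X (fun U => ~ x \at U)
  (fun U V VU nU Vx => nU (VU x Vx)) _ _) => *; apply: off_irr.
Defined.

Lemma off_is_sheaf : is_sheaf off_presheaf.
Proof.
move=> V I U UV cov s cmp.
have nV : ~ x \at V by rewrite cov => -[i _ /(s i)].
by exists nV; split=> [i|t _]; apply: off_irr.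
Qed.

Definition off : Sh X := Sheaf off_is_sheaf.

Lemma sky_hom_eq (Z : sheaf X) (g h : sheaf_hom Z sky) :
  (forall (U : opens X) (s : Z U) (Ux : x \at U), g U s Ux <-> h U s Ux) ->
  g = h.
Proof.
by move=> e; apply: sheaf_hom_eq => U s; apply/funext => Ux; apply/propext.
Qed.

(** [s] and [t] are both defined at [x] and have the same germ there. *)
Definition germ_eq (D : sheaf X) (U V : opens X) (s : D U) (t : D V) : Prop :=
  exists (W : opens X) (WU : W `<=` U) (WV : W `<=` V),
    x \at W /\ res WU s = res WV t.

Lemma germ_eq_res (D : sheaf X) (U U' V : opens X) (s : D U) (t : D V)
    (U'U : U' `<=` U) :
  x \at U' -> germ_eq (res U'U s) t <-> germ_eq s t.
Proof.
move=> U'x; split=> [[W [WU' [WV [Wx e]]]]|[W [WU [WV [Wx e]]]]].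
  exists W, (subset_trans WU' U'U), WV.
  by rewrite -res_resE.
exists (openI_opens W U'), (@openIr _ _ _), (subset_trans (@openIl _ _ _) WV).
split=> //; rewrite -[RHS]res_resE -e; exact: res_comm.
Qed.

(** The map to the skyscraper that sends a germ at [x] to [p] if it is the germ of
    [d], and to [False] otherwise. *)
Definition germ_hom (D : sheaf X) (U : opens X) (d : D U) (p : Prop) :
  sheaf_hom D sky.
Proof.
refine (@SheafHom X D sky (fun V e _ => germ_eq e d /\ p) _).
move=> V V' V'V e; apply/funext => V'x; apply/propext => /=.
by rewrite germ_eq_res.
Defined.

(** The sections that do not have the germ of [d] at [x]; in particular those that
    are not defined at [x]. *)
Definition off_germ (D : sheaf X) (U : opens X) (d : D U) (V : opens X)
    (e : D V) : Prop :=
  ~ germ_eq e d.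

Lemma off_germ_res (D : sheaf X) (U : opens X) (d : D U) (V W : opens X)
  (WV : W `<=` V) (e : D V) : off_germ d e -> off_germ d (res WV e).
Proof.
move=> ne ge; apply: ne; move: (ge) => [W' [W'W [_ [W'x _]]]].
by move: ge; rewrite germ_eq_res //; apply: W'W.
Qed.

Lemma off_germ_local (D : sheaf X) (U : opens X) (d : D U) (V : opens X)
    (e : D V) :
  (forall y, y \at V -> exists (W : opens X) (WV : W `<=` V),
     y \at W /\ off_germ d (res WV e)) -> off_germ d e.
Proof.
move=> h ge; move: (ge) => [W' [W'V [_ [W'x _]]]].
have [W [WV [Wx]]] := h x (W'V x W'x); apply.
by apply/germ_eq_res.
Qed.

Definition off_sheaf (D : sheaf X) (U : opens X) (d : D U) : Sh X :=
  subsheaf (@off_germ_res D U d) (@off_germ_local D U d).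

Definition off_incl (D : Sh X) (U : opens X) (d : D U) : hom (off_sheaf d) D :=
  subsheaf_incl (@off_germ_res D U d) (@off_germ_local D U d).

Lemma off_incl_mono (D : Sh X) (U : opens X) (d : D U) : is_mono (off_incl d).
Proof.
move=> Z g h e; apply: sheaf_hom_eq => V s; apply: sig_eq.
exact: (congr1 (fun k : sheaf_hom Z D => k V s) e).
Qed.

Lemma sec_mono (D : Sh X) (U : opens X) (d : D U) :
  is_mono (sec d : hom (yo U) D).
Proof. by move=> Z g h _; apply: sheaf_hom_eq => V s; apply: subset_irr. Qed.

Lemma germ_hom_off (D : Sh X) (U : opens X) (d : D U) (p p' : Prop) :
  (germ_hom d p : hom D sky) \oc off_incl d =
  (germ_hom d p' : hom D sky) \oc off_incl d.
Proof. by apply: sky_hom_eq => V [e ne] Vx; split=> -[]. Qed.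

(** Every map [yo U -> sky] extends along [d] by the constant [False]. *)
Lemma germ_hom_sec (D : Sh X) (U : opens X) (d : D U) (g : hom (yo U) sky) :
  exists p : Prop, (germ_hom d p : hom D sky) \oc sec d = g.
Proof.
exists (exists Ux, g U (@subset_refl _ U) Ux); apply: sky_hom_eq => V VU Vx /=.
have e Ux : g V VU Vx = g U (@subset_refl _ U) Ux.
  have := congr1 (fun k => k Vx) (sheaf_app_res g VU (@subset_refl _ U)).
  rewrite /= (Prop_irrelevance (VU x Vx) Ux) => <-.
  by congr (g V _ _); apply: subset_irr.
split=> [[_ [Ux]]|h]; first by rewrite e.
split; last by exists (VU x Vx); rewrite -e.
by apply/germ_eq_res => //; exists V, VU, VU.
Qed.

(** The cover of [D] by the section [d] and by the subsheaf [off_sheaf d]. *)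
Definition germ_coverO (D : Sh X) (U : opens X) (d : D U) (b : bool) : Sh X :=
  if b then yo U else off_sheaf d.

Definition germ_cover (D : Sh X) (U : opens X) (d : D U) (b : bool) :
  hom (germ_coverO d b) D :=
  match b with true => sec d | false => off_incl d end.

Lemma germ_cover_effective (D : Sh X) (U : opens X) (d : D U) :
  closed_points X x -> effective_epic (germ_cover d).
Proof.
move=> clx; apply: locally_surjective_effective => V e y Vy.
have [[W [WV [WU [Wx eW]]]]|ne] := pselect (germ_eq e d); last first.
  by exists V, (@subset_refl _ V), false, (exist _ e ne); rewrite /= res_id.
(* [e] agrees with [d] on [W], and away from the closed point [x] it belongs
   to [off_sheaf d]. *)
have [Wy|nWy] := pselect (y \at W).
  by exists W, WV, true, WU.
pose V' : opens X := exist _ ((V : set X) `&` ~` [set x])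
  (openI (svalP V) (closed_openC clx)).
have V'V : V' `<=` V by move=> z [].
have nV' : off_germ d (res V'V e).
  by move=> [W' [W'V' [_ [W'x _]]]]; have [_ []] := W'V' x W'x.
exists V', V'V, false, (exist _ _ nV'); split=> //; split=> // yx.
by apply: nWy; rewrite yx.
Qed.

(** The two pieces of the cover meet away from [x] only. *)
Lemma germ_overlap (D Z : Sh X) (U : opens X) (d : D U) (z : hom Z (yo U))
    (z' : hom Z (off_sheaf d)) :
  (sec d : hom (yo U) D) \oc z = off_incl d \oc z' ->
  inhabited (hom Z off).
Proof.
move=> e; have nZ (W : opens X) (c : Z W) : ~ x \at W.
  move=> Wx; apply: (svalP (z' W c)); exists W, (@subset_refl _ W), (z W c).
  split=> //; rewrite res_id.
  exact: (esym (congr1 (fun k : sheaf_hom Z D => k W c) e)).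
constructor.
by refine (@SheafHom X Z off nZ _) => *; apply: off_irr.
Qed.

Definition off_sky : sheaf_hom off sky.
Proof.
refine (@SheafHom X off sky (fun U nU Ux => False) _).
by [].
Defined.

(** Over [off], the sheaf [sky] is terminal.  This is stated as a pullback over the
    terminal object, a form that is preserved by left exact functors. *)
Lemma off_sky_pullback (s : hom sky (one_sheaf X)) (t : hom off (one_sheaf X)) :
  is_pullback s t (off_sky : hom off sky) (idm off).
Proof.
split.
  have [r [_ ru]] := @one_terminal X off.
  by rewrite -(ru t) // -(ru (s \oc _)) ?comp_idr.
move=> Z z1 z2 _; exists z2; split=> [|z [_ <-]]; last by rewrite comp_idl.
rewrite comp_idl; split=> //; apply: sky_hom_eq => U c Ux.
by case: (z2 U c Ux).
Qed.

End Covers.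

(** * Skyscrapers at closed points of a Jacobson space detect isomorphisms *)

Lemma jacobson_iso (X : topologicalType) (M Q : Sh X) (u : hom M Q) :
  Jacobson X ->
  (forall x, closed_points X x -> forall t : hom M (sky x),
     exists! r : hom Q (sky x), r \oc u = t) ->
  is_iso u.
Proof.
move=> jac test.
(* A local property of points that holds at the closed points of [U] holds on
   all of [U]. *)
have full (U : opens X) (P : X -> Prop) :
    (forall x, x \at U -> P x ->
       exists W : opens X, [/\ W `<=` U, x \at W & W `<=` P]) ->
    (forall x, closed_points X x -> x \at U -> P x) ->
    forall x, x \at U -> P x.
  move=> Ploc Pcl.
  have oP : open ((U : set X) `&` P).
    apply: open_local => x [Ux Px]; have [W [WU Wx WP]] := Ploc x Ux Px.
    by exists W; split=> // y Wy; split; [apply: WU|apply: WP].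
  have <- : (U : set X) `&` P = U.
    apply: (jac _ _ oP (svalP U)); apply/seteqP; split=> x [h cx].
      by split=> //; case: h.
    by split=> //; split=> //; apply: Pcl.
  by move=> x [].
have inj (U : opens X) (a b : M U) : u U a = u U b -> a = b.
  move=> e; apply: sheaf_sep.
  apply: (full U (fun x => exists (W : opens X) (WU : W `<=` U),
      x \at W /\ res WU a = res WU b)).
    move=> x Ux [W [WU [Wx eW]]]; exists W; split=> // y Wy.
    by exists W, WU.
  (* The map that recognizes the germ of [a] factors through [u], hence takes
     the same value at [a] and at [b]. *)
  move=> x cx Ux; have [r [rE _]] := test x cx (germ_hom x a True).
  have := congr1 (fun k : sheaf_hom M (sky x) => (k U a Ux, k U b Ux)) rE.
  rewrite /= e => -[e1 e2].
  have /= : germ_eq x b a /\ True.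
    rewrite -e2 e1; split=> //.
    by exists U, (@subset_refl _ U), (@subset_refl _ U).
  move=> [[W [WU [WU' [Wx eW]]]] _]; exists W, WU; split=> //.
  by rewrite eW; apply: res_irr.
have um : is_mono u.
  move=> Z g h e; apply: sheaf_hom_eq => U c; apply: inj.
  exact: (congr1 (fun k : sheaf_hom Z Q => k U c) e).
have surj (U : opens X) (c : Q U) : exists s, u U s = c.
  apply: in_image_local um _ _ _.
  apply: (full U (fun x => exists (W : opens X) (WU : W `<=` U),
      x \at W /\ exists s, u W s = res WU c)).
    move=> x Ux [W [WU [Wx eW]]]; exists W; split=> // y Wy.
    by exists W, WU.
  (* If [c] were not in the image near [x], the map that recognizes the germ
     of [c] and the constant map [False] would agree on [M]. *)
  move=> x cx Ux; apply: contrapT => nx.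
  have [r [_ ru]] := test x cx ((germ_hom x c False : hom Q (sky x)) \oc u).
  have e : germ_hom x c True = germ_hom x c False.
    rewrite -(ru (germ_hom x c False)) // -(ru (germ_hom x c True)) //.
    apply: sky_hom_eq => V m Vx /=; split=> -[] // [W [WV [WU [Wx eW]]]] _.
    case: nx; exists W, WU; split=> //; exists (res WV m).
    by rewrite sheaf_app_res.
  have : germ_eq x c c /\ True.
    by split=> //; exists U, (@subset_refl _ U), (@subset_refl _ U).
  have := congr1 (fun k : sheaf_hom Q (sky x) => k U c Ux) e => /= ->.
  by case.
have [k uk] := sh_lift um (z := idm Q) surj.
exact: split_mono_iso um uk.
Qed.

(** * Essential geometric morphisms at a closed point *)

Lemma lex_mono (C D : category) (G : functor C D) (A B : C) (m : hom A B) :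
  preserves_finite_limits G -> is_mono m -> is_mono (fmap G m).
Proof.
move=> [_ lex] mm.
have pb : is_pullback m m (idm A) (idm A).
  split=> // Z z1 z2 /mm <-; exists z1; split=> [|z [<- _]].
    by rewrite comp_idl.
  by rewrite comp_idl.
have [_ pbG] := lex _ _ _ _ _ _ _ _ pb.
move=> Z g h /pbG [k [[k1 k2] _]].
by rewrite -k1 -k2.
Qed.

Section Essential.
Variables (X : topologicalType) (F : category).
Variable gm : geometric_morphism F (Sh X).
Hypothesis topF : elementary_topos F.
Notation fs := (inverse_image gm).
Variables (shriek : functor F (Sh X)) (adj : adjunction shriek fs).
Variable x : X.
Hypothesis clx : closed_points X x.

(** Left exactness of [f^*] carries over to [F] that [sky x] is terminal away from
    [x]. *)
Lemma off_sky_unique (W : F) (v : hom W (fs (off x)))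
  (t t' : hom W (fs (sky x))) : t = t'.
Proof.
have [s _] := @one_terminal X (sky x); have [o _] := @one_terminal X (off x).
have [lexT lexP] := inverse_image_lex gm.
have [_ pb] := lexP _ _ _ _ _ _ _ _ (off_sky_pullback s o).
have tE (r : hom W (fs (sky x))) :
    r = fmap fs (off_sky x : hom (off x) (sky x)) \oc v.
  have [|k [[<- <-] _]] := pb W r v.
    have [c [_ cu]] := lexT _ (@one_terminal X) W.
    by rewrite -(cu (_ \oc r)) // -(cu (_ \oc v)).
  by rewrite fmap_id comp_idl.
by rewrite (tE t) (tE t').
Qed.

(** [Yd] is the part of [Y] over the section [d] of [shriek Y]. *)
Section Component.
Variables (Y : F) (U : opens X) (d : (shriek Y : Sh X) U).
Variables (Yd : F) (y : hom Yd Y) (rho : hom Yd (fs (yo U))).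
Hypothesis pbd :
  is_pullback (unit adj Y) (fmap fs (sec d : hom (yo U) (shriek Y))) y rho.

Lemma component_joint (W : F) (k k' : hom W Yd) : y \oc k = y \oc k' -> k = k'.
Proof.
move=> e; apply: (pullback_joint pbd e).
apply: (lex_mono (inverse_image_lex gm) (@sec_mono _ _ _ d)).
by rewrite !comp_assoc -pbd.1 -!comp_assoc e.
Qed.

(** A generalized element of [Y] over both pieces of the cover of [shriek Y] lies
    away from [x]. *)
Lemma component_overlap (W : F) (k : hom W Yd) (v : hom W (fs (off_sheaf x d)))
    (t t' : hom W (fs (sky x))) :
  unit adj Y \oc (y \oc k) = fmap fs (off_incl x d) \oc v -> t = t'.
Proof.
rewrite comp_assoc pbd.1 -comp_assoc => e.
have [Z [z [z' pb]]] := (sh_has_finite_limits X).2 _ _ _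
  (sec d : hom (yo U) (shriek Y)) (off_incl x d).
have [_ pbF] := (inverse_image_lex gm).2 _ _ _ _ _ _ _ _ pb.
have [k' _] := pbF _ _ _ e.
have [o] := germ_overlap pb.1.
exact: off_sky_unique (fmap fs o \oc k') _ _.
Qed.

(** Extended by the constant [False] to the part of [Y] over [off_sheaf x d], [g]
    becomes a map on [Y]; [r] is the restriction to [d] of its transpose. *)
Lemma component_factor (g : hom Yd (fs (sky x))) :
  exists r : hom (yo U) (sky x), g = fmap fs r \oc rho.
Proof.
pose c0 : hom (off_sheaf x d) (sky x) :=
  (germ_hom x d False : hom (shriek Y) (sky x)) \oc off_incl x d.
pose rel (W : F) (w : hom W Y) (n : hom W (fs (sky x))) :=
  (exists k : hom W Yd, w = y \oc k /\ n = g \oc k) \/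
  (exists v : hom W (fs (off_sheaf x d)),
     unit adj Y \oc w = fmap fs (off_incl x d) \oc v /\ n = fmap fs c0 \oc v).
have relf (W : F) (w : hom W Y) (n n' : hom W (fs (sky x))) :
    rel W w n -> rel W w n' -> n = n'.
  move=> [[k [-> ->]]|[v [e ->]]] [[k' [e' ->]]|[v' [e' ->]]].
  - by rewrite (component_joint e').
  - exact: component_overlap e'.
  - by rewrite e' in e; apply: component_overlap e.
  - congr (_ \oc _).
    apply: (lex_mono (inverse_image_lex gm) (@off_incl_mono _ _ _ _ d)).
    by rewrite -e -e'.
have [|||n nE] := pullback_glue topF (germ_cover_effective d clx)
  (p := unit adj Y) (rel := rel).
- move=> W W' k w n [[j [-> ->]]|[v [e ->]]].
    by left; exists (j \oc k); rewrite !comp_assoc.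
  by right; exists (v \oc k); rewrite !comp_assoc e.
- exact: relf.
- move=> [] W w v e; last by exists (fmap fs c0 \oc v); right; exists v.
  have [k [[k1 _] _]] := pbd.2 W w v e.
  by exists (g \oc k); left; exists k.
exists (untransp adj n \oc (sec d : hom (yo U) (shriek Y))).
rewrite fmap_comp -comp_assoc -pbd.1 comp_assoc -transpE untranspK.
apply: (relf Yd y); first by left; exists (idm Yd); rewrite !comp_idr.
exact: (nE true Yd y rho pbd.1).
Qed.

Lemma component_inj (r1 r2 : hom (yo U) (sky x)) :
  fmap fs r1 \oc rho = fmap fs r2 \oc rho -> r1 = r2.
Proof.
move=> e.
have [p1 p1E] := germ_hom_sec d r1; have [p2 p2E] := germ_hom_sec d r2.
suff h : (germ_hom x d p1 : hom (shriek Y) (sky x)) = germ_hom x d p2.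
  by rewrite -p1E -p2E h.
apply: (transp_inj (adj := adj)); rewrite !transpE.
apply: (pullback_epic topF (germ_cover_effective d clx).1 (p := unit adj Y)).
move=> [] W w v ew; rewrite -!comp_assoc ew !comp_assoc -!fmap_comp.
  have [k [[_ <-] _]] := pbd.2 W w v ew.
  by rewrite p1E p2E !comp_assoc e.
by rewrite [_ \oc germ_cover x d false](germ_hom_off x d p1 p2).
Qed.
End Component.

(** [P] is the pullback of [Y] along [q : Q -> shriek Y]. *)
Section Family.
Variables (Y : F) (Q : Sh X) (q : hom Q (shriek Y)).
Variables (P : F) (p : hom P Y) (kappa : hom P (fs Q)).
Hypothesis pbP : is_pullback (unit adj Y) (fmap fs q) p kappa.
Variable phi : hom P (fs (sky x)).

(** On the part of [P] over the section [s] of [Q], [phi] is given by [r]. *)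
Definition restricts_to (U : opens X) (s : hom (yo U) Q)
    (r : hom (yo U) (sky x)) : Prop :=
  forall (W : F) (w : hom W P) (v : hom W (fs (yo U))),
    kappa \oc w = fmap fs s \oc v -> phi \oc w = fmap fs r \oc v.

Lemma section_factor (U : opens X) (s : Q U) :
  exists! r : hom (yo U) (sky x), restricts_to (sec s) r.
Proof.
have [[_ lims] _ _] := topF.
have [Yd [y [rho pbd]]] := lims _ _ _ (unit adj Y)
  (fmap fs (sec (q U s) : hom (yo U) (shriek Y))).
have qs : fmap fs q \oc fmap fs (sec s : hom (yo U) Q) =
    fmap fs (sec (q U s) : hom (yo U) (shriek Y)).
  by rewrite -fmap_comp sec_comp.
have [|k [[k1 k2] _]] := pbP.2 Yd y (fmap fs (sec s : hom (yo U) Q) \oc rho).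
  by rewrite comp_assoc qs pbd.1.
have [r rE] := component_factor pbd (phi \oc k).
exists r; split=> [W w v e|r' r'E].
  have [|j [[j1 j2] _]] := pbd.2 W (p \oc w) v.
    by rewrite comp_assoc pbP.1 -comp_assoc e comp_assoc qs.
  have <- : k \oc j = w.
    apply: (pullback_joint pbP); rewrite comp_assoc ?k1 ?k2 //.
    by rewrite -comp_assoc j2 e.
  by rewrite comp_assoc rE -comp_assoc j2.
by apply: (component_inj pbd); rewrite -rE; apply: r'E.
Qed.

Lemma family_factor : exists! r : hom Q (sky x), fmap fs r \oc kappa = phi.
Proof.
have ex (s : {U : opens X & Q U}) :
    exists r : hom (yo (projT1 s)) (sky x), restricts_to (all_sections s) r.
  by have [r [? _]] := section_factor (projT2 s); exists r.
have [r rE] := choice_fun ex.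
have runiq (U : opens X) (s : Q U) (r1 r2 : hom (yo U) (sky x)) :
    restricts_to (sec s) r1 -> restricts_to (sec s) r2 -> r1 = r2.
  move=> h1 h2; have [r0 [_ u]] := section_factor s.
  by rewrite -(u r1) // -(u r2).
have [|r0 r0E] := (all_sections_effective Q).2 _ r.
  move=> Z s t z z' e; apply: (all_sections_effective Z).1 => -[W c].
  rewrite -!comp_assoc; set c' := all_sections _.
  have sE : sec ((all_sections s \oc z) W c) = all_sections s \oc (z \oc c').
    by rewrite -sec_comp comp_assoc.
  apply: (runiq W ((all_sections s \oc z) W c)) => W' w v; rewrite sE.
    by rewrite !fmap_comp -!comp_assoc; apply: rE.
  rewrite comp_assoc e -comp_assoc.
  by rewrite !fmap_comp -!comp_assoc; apply: rE.
exists r0; split=> [|r' r'E].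
  apply: (pullback_epic topF (all_sections_effective Q).1 (p := kappa)).
  move=> s W w v e.
  rewrite -comp_assoc e comp_assoc -fmap_comp r0E; exact/esym/rE.
apply: (all_sections_effective Q).1 => -[U s]; apply: (runiq U s) => W w v e.
  rewrite r0E; exact: (rE (existT _ U s) W w v e).
by rewrite -r'E -comp_assoc e comp_assoc fmap_comp.
Qed.
End Family.
End Essential.

(** * Local connectedness *)

(** The right adjoint turns the second square into a pullback, whose pasting with
    the conclusion is the first one. *)
Lemma unit_pullback (C D : category) (L : functor C D) (R : functor D C)
    (adj : adjunction L R) (A B Q : D) (a : hom A B) (X P : C) (x : hom X (R B))
    (p1 : hom P X) (p2 : hom P (R A)) (q1 : hom Q (L X)) (q2 : hom Q A)
    (u : hom (L P) Q) :
  preserves_finite_limits R ->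
  is_pullback x (fmap R a) p1 p2 ->
  is_pullback (untransp adj x) a q1 q2 ->
  q1 \oc u = fmap L p1 -> q2 \oc u = untransp adj p2 ->
  is_pullback (unit adj X) (fmap R q1) p1 (transp adj u).
Proof.
move=> [_ lexR] pbP pbQ u1 u2; have pbR := lexR _ _ _ _ _ _ _ _ pbQ.
have k1 : fmap R q1 \oc transp adj u = unit adj X \oc p1.
  by rewrite -transp_postcomp u1 -transp_precomp comp_idl.
have k2 : fmap R q2 \oc transp adj u = p2.
  by rewrite -transp_postcomp u2 untranspK.
have xE : fmap R (untransp adj x) \oc unit adj X = x.
  by rewrite -transpE untranspK.
split=> // Z z1 z2 e.
have [|k [[e1 e2] ku]] := pbP.2 Z z1 (fmap R q2 \oc z2).
  by rewrite -{1}xE -comp_assoc e !comp_assoc pbR.1.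
exists k; split=> [|k' [e1' e2']]; last first.
  by apply: ku; rewrite e1' -k2 -comp_assoc e2'.
split=> //; apply: (pullback_joint pbR).
  by rewrite comp_assoc k1 -comp_assoc e1.
by rewrite comp_assoc k2 e2.
Qed.

Theorem theorem3p3 (X : topologicalType) (hX : Jacobson X) : EILC (Sh X).
Proof.
split; first exact: sh_elementary_topos.
move=> F topF f [fshriek [adj]]; exists fshriek, adj.
move=> A B a Y y P p1 p2 Q q1 q2 pbP pbQ.
have [|u [[u1 u2] _]] := pbQ.2 (fshriek P) (fmap fshriek p1) (untransp adj p2).
  apply: (transp_inj (adj := adj)).
  by rewrite transp_precomp transp_postcomp !untranspK pbP.1.
exists u; split=> //; apply: jacobson_iso => // x clx t.
have pb := unit_pullback (inverse_image_lex f) pbP pbQ u1 u2.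
have [r [rE ru]] := family_factor topF clx pb (transp adj t).
exists r; split=> [|r' r'E].
  by apply: (transp_inj (adj := adj)); rewrite transp_postcomp.
by apply: ru; rewrite -transp_postcomp r'E.
Qed.
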